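(* For every integer $m\ge 3$, the graph $G_{\beta}(m;1,1,1)$ is 3-edge-colorable.
   Context: Let $G$ be the graph with the 11 vertices $A,B,A',B',v,x_1,\dots,x_6$ and the 14 edges $Av,\ vA',\ Ax_6,\ x_6x_2,\ x_6x_5,\ x_2x_4,\ x_2B,\ x_4x_3,\ x_4B',\ x_3A',\ x_3x_5,\ x_5x_1,\ x_1B,\ x_1B'$. For $m\ge3$, $G_{\beta}(m;1,1,1)$ is the cubic graph with vertex set $\{u_i: u\in V(G),\ i\in\mathbb{Z}_m\}\cup\{w_i: i\in\mathbb{Z}_m\}$ and edges $u_iu'_i$ for every edge $uu'$ of $G$, spoke edges $v_iw_i$, loop edges $w_iw_{i+1}$, and connecting edges $A'_iB_{i+1}$, $B'_iA_{i+1}$ (indices mod $m$). *)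

(* Defs.v *)
From HB Require Import structures.
From mathcomp Require Import all_boot.

Set Implicit Arguments.
Unset Strict Implicit.
Unset Printing Implicit Defensive.

(* A finite simple graph is a symmetric irreflexive adjacency relation on a
   finType; its edges are the unordered pairs of adjacent vertices. *)
Definition simple_graph (T : finType) (adj : rel T) : Prop :=
  symmetric adj /\ irreflexive adj.

Definition edges (T : finType) (adj : rel T) : {set {set T}} :=
  [set [set p.1; p.2] | p : T * T & adj p.1 p.2].

Definition proper_edge_coloring (T : finType) (adj : rel T) (k : nat)
    (c : {set T} -> 'I_k) : Prop :=
  forall E F : {set T}, E \in edges adj -> F \in edges adj ->
    E != F -> E :&: F != set0 -> c E != c F.

(* Colors assigned to sets that are not edges are irrelevant. *)
Definition edge_colorable (k : nat) (T : finType) (adj : rel T) : Prop :=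
  exists c : {set T} -> 'I_k, proper_edge_coloring adj c.

Definition cubic (T : finType) (adj : rel T) : Prop :=
  forall x : T, #|[set y | adj x y]| = 3.

Variant Gvertex : Type :=
  GA | GB | GA' | GB' | Gv | Gx1 | Gx2 | Gx3 | Gx4 | Gx5 | Gx6.

Definition Gvertex_enum : seq Gvertex :=
  [:: GA; GB; GA'; GB'; Gv; Gx1; Gx2; Gx3; Gx4; Gx5; Gx6].

Definition Gvertex_code (u : Gvertex) : nat :=
  match u with
  | GA => 0 | GB => 1 | GA' => 2 | GB' => 3 | Gv => 4 | Gx1 => 5
  | Gx2 => 6 | Gx3 => 7 | Gx4 => 8 | Gx5 => 9 | Gx6 => 10
  end.

Lemma Gvertex_codeK : cancel Gvertex_code (nth GA Gvertex_enum).
Proof. by case. Qed.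

HB.instance Definition _ := Countable.copy Gvertex (can_type Gvertex_codeK).

Lemma Gvertex_enumP : Finite.axiom Gvertex_enum.
Proof. by case. Qed.

HB.instance Definition _ := isFinite.Build Gvertex Gvertex_enumP.

Definition G_edges : seq (Gvertex * Gvertex) :=
  [:: (GA, Gv); (Gv, GA'); (GA, Gx6); (Gx6, Gx2); (Gx6, Gx5); (Gx2, Gx4);
      (Gx2, GB); (Gx4, Gx3); (Gx4, GB'); (Gx3, GA'); (Gx3, Gx5); (Gx5, Gx1);
      (Gx1, GB); (Gx1, GB')].

(* [inl (u, i)] is the vertex u_i and [inr i] is the vertex w_i. *)
Definition Gbeta_vertex (m : nat) : finType := (Gvertex * 'I_m + 'I_m)%type.

(* One orientation of every edge of G_beta(m;1,1,1); [ordS i] is i + 1 mod m. *)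
Definition Gbeta_arc (m : nat) (x y : Gbeta_vertex m) : bool :=
  match x, y with
  | inl (u, i), inl (u', j) =>
      [|| (i == j) && ((u, u') \in G_edges),
          [&& u == GA', u' == GB & j == ordS i]
        | [&& u == GB', u' == GA & j == ordS i]]
  | inl (u, i), inr j => (u == Gv) && (i == j)
  | inr i, inr j => j == ordS i
  | inr _, inl _ => false
  end.

Definition Gbeta (m : nat) : rel (Gbeta_vertex m) :=
  fun x y => Gbeta_arc x y || Gbeta_arc y x.

Arguments Gbeta m : clear implicits.

Lemma Gbeta_simple (m : nat) : 2 <= m -> simple_graph (Gbeta m).
Proof.
move=> m2; split=> [x y|]; first by rewrite /Gbeta orbC.
case=> [[u i]|i]; rewrite /Gbeta orbb /=; first by case: u; rewrite ?eqxx.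
apply/negP => /eqP /(congr1 val) /= ii; have := ltn_ord i.
rewrite leq_eqVlt => /orP[/eqP im|im].
  by rewrite im modnn in ii; rewrite ii in im; rewrite -im in m2.
by rewrite modn_small // in ii; case: (n_Sn i).
Qed.

Lemma Gbeta_cubic (m : nat) : 3 <= m -> cubic (Gbeta m).
Proof.
move=> m3.
have card3 (T : finType) (P : pred T) (a b c : T) :
    P =1 pred3 a b c -> uniq [:: a; b; c] -> #|[set y | P y]| = 3.
  move=> eP /card_uniqP /= <-; apply: eq_card => y.
  by rewrite !inE eP.
have predE (i j : 'I_m) : (i == ordS j) = (j == ord_pred i).
  by apply/eqP/eqP => ->; rewrite ?ordSK ?ord_predK.
have npred (i : 'I_m) : ordS i != ord_pred i.
  have m0 : 0 < m by apply: leq_trans m3.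
  rewrite -predE; apply/eqP => /(congr1 val) /= ii.
  have : i = (i + 2) %[mod m].
    by rewrite modn_small // {1}ii -addn1 modnDml addn1 addn2.
  move/eqP; rewrite -{1}[nat_of_ord i]addn0 eqn_modDl mod0n.
  by rewrite modn_small.
case=> [[u i]|i].
- pose nb : Gbeta_vertex m * Gbeta_vertex m * Gbeta_vertex m :=
    match u with
    | GA => (inl (Gv, i), inl (Gx6, i), inl (GB', ord_pred i))
    | GB => (inl (Gx2, i), inl (Gx1, i), inl (GA', ord_pred i))
    | GA' => (inl (Gv, i), inl (Gx3, i), inl (GB, ordS i))
    | GB' => (inl (Gx4, i), inl (Gx1, i), inl (GA, ordS i))
    | Gv => (inl (GA, i), inl (GA', i), inr i)
    | Gx1 => (inl (Gx5, i), inl (GB, i), inl (GB', i))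
    | Gx2 => (inl (Gx6, i), inl (Gx4, i), inl (GB, i))
    | Gx3 => (inl (Gx4, i), inl (GA', i), inl (Gx5, i))
    | Gx4 => (inl (Gx2, i), inl (Gx3, i), inl (GB', i))
    | Gx5 => (inl (Gx6, i), inl (Gx3, i), inl (Gx1, i))
    | Gx6 => (inl (GA, i), inl (Gx2, i), inl (Gx5, i))
    end.
  apply: (@card3 _ _ nb.1.1 nb.1.2 nb.2); last by rewrite /nb; case: (u).
  rewrite /nb /Gbeta => -[[u' j]|j]; last first.
    by case: (u); rewrite //= ?orbF //= eq_sym.
  have inlE (u1 u2 : Gvertex) (j1 j2 : 'I_m) :
      (inl (u1, j1) == inl (u2, j2) :> Gbeta_vertex m) = (u1 == u2) && (j1 == j2).
    by [].
  have inlrE (u1 : Gvertex) (j1 j2 : 'I_m) :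
      (inl (u1, j1) == inr j2 :> Gbeta_vertex m) = false by [].
  rewrite /Gbeta_arc (eq_sym i j) (predE i).
  by case: (u); rewrite /= ?inlE ?inlrE; move: (j == i) (j == ordS i) (j == ord_pred i);
    case: u' => -[] [] [].
apply: (@card3 _ _ (inl (Gv, i)) (inr (ordS i)) (inr (ord_pred i))).
  move=> -[[u j]|j] /=; rewrite /Gbeta /=; last by rewrite (predE i).
  by rewrite ?orbF; case: u.
rewrite /= !inE /= andbT; exact: npred.
Qed.

(* Main.v *)
Require Import Defs.
From mathcomp Require Import all_boot.

(** Give block [i] a state [s] in Z/3: its three incoming edges, at [B], [A] and
    [w], get the colors [s], [s + 1] and [s + 2].  A block with state [s] can be
    colored so that the next block has state [s + 1], and also so that it has
    state [s + 2].  Hence every proper 3-coloring of the cycle of length [m]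
    yields a proper 3-edge-coloring of the graph. *)

Lemma uniq_map_in_inj (T1 T2 : eqType) (f : T1 -> T2) (s : seq T1) :
  uniq [seq f x | x <- s] -> {in s &, injective f}.
Proof.
elim: s => //= a s IHs /andP[fa_notin /IHs f_inj] x y; rewrite !inE.
case/predU1P=> [->|xs] /predU1P[->|ys] // fxy; last exact: f_inj.
- by rewrite fxy map_f in fa_notin.
- by rewrite -fxy map_f in fa_notin.
Qed.

(** An edge is an unordered set, so its color is read off an arbitrarily picked orientation;
    symmetry of [f] makes the pick irrelevant. Distinct edges meeting at [x] are [[set x; y]] and
    [[set x; z]] with [y != z], and injectivity of [f x] separates them. *)
Lemma edge_colorable_darts (k : nat) (T : finType) (adj : rel T)
    (f : T -> T -> 'I_k.+1) :
  symmetric adj -> (forall x y, adj x y -> f x y = f y x) ->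
  (forall x, {in adj x &, injective (f x)}) ->
  edge_colorable k.+1 adj.
Proof.
move=> adjC fC f_inj.
pose is_dart (E : {set T}) (p : T * T) := adj p.1 p.2 && (E == [set p.1; p.2]).
pose c (E : {set T}) : 'I_k.+1 :=
  if [pick p | is_dart E p] is Some p then f p.1 p.2 else ord0.
have dart_at (E : {set T}) x : E \in edges adj -> x \in E ->
    exists y, [/\ adj x y, E = [set x; y] & c E = f x y].
  case/imsetP=> -[a b]; rewrite inE /= => ab E_ab xE.
  rewrite /c; case: pickP => [[p q]|/(_ (a, b))].
    case/andP=> /= pq /eqP E_pq; move: xE; rewrite E_pq !inE => /orP[]/eqP->.
      by exists q.
    by exists p; split; [rewrite adjC | rewrite setUC | rewrite fC].
  by rewrite /is_dart /= -E_ab eqxx ab.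
exists c => E F Eadj Fadj neqEF /set0Pn[x /setIP[xE xF]].
apply: contra_neq neqEF.
have [y [xy -> ->]] := dart_at _ _ Eadj xE.
have [z [xz -> ->]] := dart_at _ _ Fadj xF.
by move/(f_inj x y z xy xz)->.
Qed.

Lemma cycle_3colorable (m : nat) : 2 <= m ->
  exists s : 'I_m -> 'I_3, forall i, s i != s (ordS i).
Proof.
move=> m2.
(* Colors alternate 0, 1 by parity, except that the last index gets 1 for even [m] and 2 for odd
   [m]: this differs from 0 at index 0 and from [odd m] at index [m - 2]. *)
exists (fun i => if i.+1 == m then inord (odd m).+1 else inord (odd i)) => i.
have lt_odd b : nat_of_bool b < 3 by case: b.
have lt_oddS b : (nat_of_bool b).+1 < 3 by case: b.
have [im|im] /= := eqVneq i.+1 m.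
  rewrite im modnn; case: (1 =P m) => [m1|_]; first by rewrite -m1 in m2.
  by rewrite -val_eqE /= !inordK.
have lt_im : i.+1 < m by rewrite ltn_neqAle im ltn_ord.
rewrite modn_small //; case: (i.+2 =P m) => [iSm|_]; rewrite -val_eqE /= !inordK //=.
  by move/(congr1 odd): iSm; rewrite /= negbK => <-; case: (odd i).
by case: (odd i).
Qed.

Lemma ord_pred_neq_ordS (m : nat) (i : 'I_m) : 3 <= m -> ord_pred i != ordS i.
Proof.
move=> m3; apply/eqP => /(congr1 (@ordS m)); rewrite ord_predK.
move/(congr1 val) => /= /eqP; rewrite -addn1 modnDml addn1 -addn2.
rewrite -[X in X == _](modn_small (ltn_ord i)) -[X in X == _ %[mod m]]addn0.
by rewrite eqn_modDl mod0n modn_small.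
Qed.

(** A list, so that properness at a vertex becomes [uniq] of three explicit colors. *)
Definition Gbeta_neighbors (m : nat) (x : Gbeta_vertex m) :
    seq (Gbeta_vertex m) :=
  match x with
  | inl (GA, i) => [:: inl (Gv, i); inl (Gx6, i); inl (GB', ord_pred i)]
  | inl (GB, i) => [:: inl (Gx2, i); inl (Gx1, i); inl (GA', ord_pred i)]
  | inl (GA', i) => [:: inl (Gv, i); inl (Gx3, i); inl (GB, ordS i)]
  | inl (GB', i) => [:: inl (Gx4, i); inl (Gx1, i); inl (GA, ordS i)]
  | inl (Gv, i) => [:: inl (GA, i); inl (GA', i); inr i]
  | inl (Gx1, i) => [:: inl (Gx5, i); inl (GB, i); inl (GB', i)]
  | inl (Gx2, i) => [:: inl (Gx6, i); inl (Gx4, i); inl (GB, i)]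
  | inl (Gx3, i) => [:: inl (Gx4, i); inl (GA', i); inl (Gx5, i)]
  | inl (Gx4, i) => [:: inl (Gx2, i); inl (Gx3, i); inl (GB', i)]
  | inl (Gx5, i) => [:: inl (Gx6, i); inl (Gx3, i); inl (Gx1, i)]
  | inl (Gx6, i) => [:: inl (GA, i); inl (Gx2, i); inl (Gx5, i)]
  | inr i => [:: inl (Gv, i); inr (ordS i); inr (ord_pred i)]
  end.

Lemma Gbeta_neighborsP (m : nat) (x y : Gbeta_vertex m) :
  Gbeta m x y -> y \in Gbeta_neighbors m x.
Proof.
have predE (i j : 'I_m) : (i == ordS j) = (j == ord_pred i).
  by apply/eqP/eqP => ->; rewrite ?ordSK ?ord_predK.
have inlE (u1 u2 : Gvertex) (j1 j2 : 'I_m) :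
  (inl (u1, j1) == inl (u2, j2) :> Gbeta_vertex m) = (u1 == u2) && (j1 == j2).
  by [].
have inrE (j1 j2 : 'I_m) : (inr j1 == inr j2 :> Gbeta_vertex m) = (j1 == j2).
  by [].
case: x y => [[u i]|i] [[u' j]|j]; rewrite /Gbeta /=.
- rewrite (eq_sym i j) (predE i).
  by case: u; rewrite /= !inE ?inlE;
    move: (j == i) (j == ordS i) (j == ord_pred i); case: u' => -[] [] [].
- by rewrite orbF => /andP[/eqP-> /eqP->]; rewrite !inE eqxx !orbT.
- by case/andP=> /eqP-> /eqP->; rewrite !inE eqxx.
- by rewrite !inE /= !inrE (predE i).
Qed.

(* Colors relative to the state of the block, listed in the order of
   [G_edges]; [step1] tells whether the next state is the successor of the
   current one. *)
Definition block_offsets (step1 : bool) : seq nat :=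
  if step1 then [:: 0; 2; 2; 0; 1; 2; 1; 1; 0; 0; 2; 0; 2; 1]
  else [:: 2; 1; 0; 2; 1; 0; 1; 1; 2; 0; 2; 0; 2; 1].

Definition block_color (s t : 'I_3) (u u' : Gvertex) : 'I_3 :=
  let e := if (u, u') \in G_edges then (u, u') else (u', u) in
  iter (nth 0 (block_offsets (t == ordS s)) (index e G_edges)) (@ordS 3) s.

(** For [s != t], the third color at [w], whose loop edges carry [s + 2] and [t + 2]. *)
Definition spoke_color (s t : 'I_3) : 'I_3 :=
  if t == ordS s then ordS s else s.

(** An edge between blocks is colored by the state of the block it enters. No edge of G joins [GA']
    to [GB] or [GB'] to [GA], so the first four cases catch connecting edges only. *)
Definition Gbeta_color (m : nat) (s : 'I_m -> 'I_3) (x y : Gbeta_vertex m) :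
    'I_3 :=
  match x, y with
  | inl (GA', _), inl (GB, j) => s j
  | inl (GB, i), inl (GA', _) => s i
  | inl (GB', _), inl (GA, j) => ordS (s j)
  | inl (GA, i), inl (GB', _) => ordS (s i)
  | inl (u, i), inl (u', _) => block_color (s i) (s (ordS i)) u u'
  | inl (_, i), inr _ | inr i, inl _ => spoke_color (s i) (s (ordS i))
  | inr i, inr j => ord_pred (s (if j == ordS i then j else i))
  end.

Lemma Gbeta_color_sym (m : nat) (s : 'I_m -> 'I_3) (x y : Gbeta_vertex m) :
  3 <= m -> Gbeta m x y -> Gbeta_color m s x y = Gbeta_color m s y x.
Proof.
move=> m3 /Gbeta_neighborsP.
case: x => [[[] i]|i]; rewrite !inE => /or3P[] /eqP-> //=.
(* A loop edge would have an ambiguous head only if [i = ordS (ordS i)], impossible for [3 <= m]. *)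
- rewrite eqxx; case: eqP => // iSS.
  by have /eqP[] := ord_pred_neq_ordS m (ordS i) m3; rewrite ordSK.
- by rewrite ord_predK eqxx (negPf (ord_pred_neq_ordS m i m3)).
Qed.

Lemma Gbeta_color_uniq (m : nat) (s : 'I_m -> 'I_3) (x : Gbeta_vertex m) :
  3 <= m -> (forall i, s i != s (ordS i)) ->
  uniq [seq Gbeta_color m s x y | y <- Gbeta_neighbors m x].
Proof.
move=> m3 s_proper.
(* The colors at a vertex depend only on [s i] and [s (ordS i)]; replacing these by arbitrary
   distinct elements of Z/3 leaves a finite check. *)
case: x => [[u i]|i]; move: (s_proper i).
  case: u => /=; move: (s i) (s (ordS i)) => a b;
    by case: a => [[|[|[|?]]] ?]; case: b => [[|[|[|?]]] ?].
rewrite /= eqxx (negPf (ord_pred_neq_ordS m i m3)).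
move: (s i) (s (ordS i)) => a b.
by case: a => [[|[|[|?]]] ?]; case: b => [[|[|[|?]]] ?].
Qed.

Theorem theorem5 (m : nat) (hm : 3 <= m) : edge_colorable 3 (Gbeta m).
Proof.
have [s s_proper] := cycle_3colorable m (ltnW hm).
apply: (@edge_colorable_darts _ _ _ (Gbeta_color m s)).
- by case: (Gbeta_simple (ltnW hm)).
- by move=> x y; apply: Gbeta_color_sym.
- move=> x y z /Gbeta_neighborsP xy /Gbeta_neighborsP xz.
  exact: uniq_map_in_inj (Gbeta_color_uniq m s x hm s_proper) _ _ xy xz.
Qed.
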